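(* Let $(X,E)$ be the graph with vertices $v_1,\dots,v_6$ and edges $\{v_1,v_3\},\{v_1,v_4\},\{v_2,v_3\},\{v_2,v_4\},\{v_4,v_5\},\{v_4,v_6\},\{v_5,v_6\}$. Let $(\bar X,\bar E)$ be the graph with vertices $\bar v_1,\dots,\bar v_6$ and edges $\{\bar v_1,\bar v_3\},\{\bar v_1,\bar v_4\},\{\bar v_2,\bar v_3\},\{\bar v_2,\bar v_4\},\{\bar v_3,\bar v_5\},\{\bar v_4,\bar v_5\},\{\bar v_5,\bar v_6\}$. Consider on both graphs the graph Laplacian with weights $\mu\equiv C$, $g\equiv 1$, where $C>0$ is a constant. Then the subsets $B=\{v_1,v_2\}\subset X$ and $\bar B=\{\bar v_1,\bar v_2\}\subset\bar X$ satisfy the following. (1) Let $\Phi:B\to\bar B$ be a bijection. Then there exist complete orthonormal families of eigenfunctions $\{\phi_j\}_{j=1}^6$ and $\{\bar\phi_j\}_{j=1}^6$ of the negative graph Laplacians of the two graphs, corresponding to eigenvalues $\lambda_j$ and $\bar\lambda_j$, such that $\lambda_j=\bar\lambda_j$ and $\phi_j|_B=\bar\phi_j\circ\Phi|_B$ for all $j$. (2) Let $C\ge 4$ and let $\Phi:B\to\bar B$ be a bijection. Let $H_t^y$ and $\bar H_t^{\bar y}$, $t\in\mathbb{N}$, be the random walks on $(X,E)$ and $(\bar X,\bar E)$ starting at $y\in X$ and $\bar y\in\bar X$ with transition probabilities $p_{xz}=1/C$ if $x\sim z$, $p_{xx}=1-\deg(x)/C$, and $p_{xz}=0$ otherwise.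 Then $$\mathbb{P}(H_t^y=z)=\mathbb{P}\big(\bar H_t^{\Phi(y)}=\Phi(z)\big)\quad\text{for all } y,z\in B,\ t\in\mathbb{N}.$$
   Context: For a finite undirected simple graph with vertex set $X$, vertex measure $\mu_x>0$ and symmetric edge weights $g_{xy}>0$, the graph Laplacian is $(\Delta_X u)(x)=\frac{1}{\mu_x}\sum_{y\sim x}g_{xy}(u(y)-u(x))$, where $x\sim y$ means $\{x,y\}$ is an edge. Eigenfunctions satisfy $-\Delta_X\phi_j=\lambda_j\phi_j$ on all of $X$, and orthonormality is with respect to $\langle u_1,u_2\rangle_{L^2(X)}=\sum_{x\in X}\mu_x u_1(x)u_2(x)$. Here $\mathbb{N}=\{0,1,2,\dots\}$. *)

(* Defs.v *)
From mathcomp Require Import all_boot all_order all_algebra.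
From mathcomp Require Import all_classical all_reals all_analysis.

Set Implicit Arguments.
Unset Strict Implicit.
Unset Printing Implicit Defensive.

Import Order.TTheory GRing.Theory Num.Theory.
Local Open Scope classical_set_scope.
Local Open Scope ring_scope.

Record sgraph (V : finType) := SGraph {
  adj :> rel V;
  adj_sym : symmetric adj;
  adj_irr : irreflexive adj }.

Section EdgeList.
Local Open Scope nat_scope.
Variable n : nat.

(* Edges are listed with 1-based labels: the vertex written v_k in the
   mathematics is the ordinal of value k - 1. *)
Definition edge_rel (s : seq (nat * nat)) : rel 'I_n :=
  fun x y => ((x.+1, y.+1) \in s) || ((y.+1, x.+1) \in s).

Lemma edge_rel_sym s : symmetric (edge_rel s).
Proof. by move=> x y; rewrite /edge_rel orbC. Qed.

Lemma edge_rel_irr s : all (fun p => p.1 != p.2) s -> irreflexive (edge_rel s).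
Proof.
move=> /allP loopless x; rewrite /edge_rel orbb.
by apply/negP => /loopless; rewrite eqxx.
Qed.

Definition edge_graph s (loopless : all (fun p => p.1 != p.2) s) : sgraph 'I_n :=
  SGraph (edge_rel_sym s) (edge_rel_irr loopless).

End EdgeList.

Definition edges_X : seq (nat * nat) :=
  [:: (1, 3); (1, 4); (2, 3); (2, 4); (4, 5); (4, 6); (5, 6)]%N.

Definition edges_Xbar : seq (nat * nat) :=
  [:: (1, 3); (1, 4); (2, 3); (2, 4); (3, 5); (4, 5); (5, 6)]%N.

Definition graph_X : sgraph 'I_6 := @edge_graph 6 edges_X isT.

Definition graph_Xbar : sgraph 'I_6 := @edge_graph 6 edges_Xbar isT.

Definition B : {set 'I_6} := [set x : 'I_6 | (x.+1 == 1%N) || (x.+1 == 2%N)]%SET.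

Definition Bbar : {set 'I_6} := [set x : 'I_6 | (x.+1 == 1%N) || (x.+1 == 2%N)]%SET.

Section Laplacian.
Variables (R : realType) (V : finType) (G : sgraph V).
Variables (mu : V -> R) (g : V -> V -> R).

Definition laplacian (u : V -> R) : V -> R :=
  fun x => (mu x)^-1 * \sum_(y | G x y) g x y * (u y - u x).

Definition L2dot (u1 u2 : V -> R) : R := \sum_x mu x * u1 x * u2 x.

Definition eigenfunction (lambda : R) (u : V -> R) : Prop :=
  (exists x, u x != 0) /\ forall x, - laplacian u x = lambda * u x.

Definition orthonormal_family (J : finType) (phi : J -> V -> R) : Prop :=
  forall i j, L2dot (phi i) (phi j) = (i == j)%:R.

Definition complete_family (J : finType) (phi : J -> V -> R) : Prop :=
  forall u : V -> R, exists c : J -> R, forall x, u x = \sum_j c j * phi j x.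

Definition complete_orthonormal_eigenfamily (J : finType)
    (lambda : J -> R) (phi : J -> V -> R) : Prop :=
  [/\ orthonormal_family phi,
      complete_family phi &
      forall j, eigenfunction (lambda j) (phi j)].

End Laplacian.

Definition degree (V : finType) (G : sgraph V) (x : V) : nat :=
  #|[set y | G x y]%SET|.

Definition transition (R : realType) (V : finType) (G : sgraph V) (C : R)
    (x z : V) : R :=
  if G x z then 1 / C
  else if x == z then 1 - (degree G x)%:R / C
  else 0.

(* The last clause is the Markov property with transition probabilities p,
     P(H_{t+1} = h_{t+1} | H_0 = h_0, ..., H_t = h_t) = p(h_t, h_{t+1}),
   multiplied out so that histories of probability 0 need no exception. *)
Definition random_walk (R : realType) (V : finType) (p : V -> V -> R) (y : V)
    (d : measure_display) (T : measurableType d) (P : probability T R)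
    (H : nat -> T -> V) : Prop :=
  [/\ forall t x, measurable (H t @^-1` [set x]),
      P [set w | H 0%N w = y] = 1%E &
      forall (t : nat) (h : nat -> V),
        P [set w | forall i, (i <= t.+1)%N -> H i w = h i] =
        (P [set w | forall i, (i <= t)%N -> H i w = h i]
          * (p (h t) (h t.+1))%:E)%E].

(* Main.v *)
Require Import Defs.
From mathcomp Require Import all_boot all_order all_algebra ring.
From mathcomp Require Import all_classical all_reals all_analysis.

Set Implicit Arguments.
Unset Strict Implicit.
Unset Printing Implicit Defensive.

Import Order.TTheory GRing.Theory Num.Theory.
Local Open Scope classical_set_scope.
Local Open Scope ring_scope.

(** Both graphs have the same Laplace spectrum, namely 0, 2, 3, 3 and
    3 + sqrt 5, 3 - sqrt 5, divided by C.  This is seen by writing down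
    eigenvectors.  Each graph has an automorphism exchanging the first two
    vertices, with eigenvector (1, -1, 0, 0, 0, 0) for the eigenvalue 2, and an
    automorphism exchanging another pair (v_5, v_6 in one graph, v_3, v_4 in the
    other), with an eigenvector for the eigenvalue 3 that vanishes on the first
    two vertices.  The four remaining eigenvectors are invariant under both
    automorphisms, hence constant on the first two vertices, and can be scaled
    to take the same value there.  What makes the claim true is that after
    this scaling corresponding eigenvectors also have the same norm, so that
    normalising them ([normalized_eigenfamily]) does not destroy the agreement.
    A bijection that exchanges the two vertices only affects the eigenvector
    of eigenvalue 2, which is compensated by changing its sign in the second
    graph ([isospectral_on_B]).

    The statement on random walks follows from the one on eigenfunctions.  With
    the given transition probabilities p, the operator u |-> p u is the identity
    plus the graph Laplacian ([transition_sum]), so its powers are diagonal in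
    the eigenbasis and

      P (H_t = z | H_0 = y) = C * \sum_j (1 - lambda_j)^t phi_j(y) phi_j(z)

    ([random_walk_law], [nstep_spectral]).  For y and z in B the right-hand side
    only involves the spectrum and the restrictions of the eigenfunctions to
    B, which coincide for the two graphs. *)

(** * Normalising an orthogonal family of eigenfunctions *)

(** As many orthonormal functions as there are points form a square matrix
    with a one-sided inverse, and a one-sided inverse is two-sided. *)
Lemma orthonormal_complete (R : realType) (n : nat) (mu : 'I_n -> R)
    (phi : 'I_n -> 'I_n -> R) :
  orthonormal_family mu phi -> complete_family phi.
Proof.
move=> ortho u.
pose A := \matrix_(i, x) (mu x * phi i x).
pose D := \matrix_(x, j) phi j x.
have AD1 : A *m D = 1%:M.
  apply/matrixP => i j; rewrite !mxE -ortho /L2dot.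
  by apply: eq_bigr => x _; rewrite !mxE.
exists (fun j => L2dot mu (phi j) u) => x.
transitivity ((D *m A *m \col_y u y) x ord0).
  by rewrite (mulmx1C AD1) mul1mx mxE.
rewrite -mulmxA mxE; apply: eq_bigr => j _; rewrite !mxE mulrC; congr (_ * _).
by apply: eq_bigr => y _; rewrite !mxE.
Qed.

(** The measure C and the factor 1 / C of the Laplacian are introduced here once
    and for all: the hypotheses on [psi] concern unit weights only. *)
Lemma normalized_eigenfamily (R : realType) (n : nat) (G : sgraph 'I_n) (C : R)
    (N nu : 'I_n -> R) (psi : 'I_n -> 'I_n -> R) :
  0 < C -> (forall j, 0 < N j) ->
  (forall i j, \sum_x psi i x * psi j x = N i *+ (i == j)) ->
  (forall j x, \sum_(y | G x y) (psi j x - psi j y) = nu j * psi j x) ->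
  complete_orthonormal_eigenfamily G (fun=> C) (fun _ _ => 1)
    (fun j => nu j / C) (fun j x => psi j x / Num.sqrt (C * N j)).
Proof.
move=> C0 N0 ortho eig.
have sq j : Num.sqrt (C * N j) ^+ 2 = C * N j.
  by rewrite sqr_sqrtr// ltW ?mulr_gt0.
have s0 j : Num.sqrt (C * N j) != 0 by rewrite gt_eqF// sqrtr_gt0 mulr_gt0.
have on : orthonormal_family (fun=> C)
    (fun j x => psi j x / Num.sqrt (C * N j)).
  move=> i j; rewrite /L2dot.
  transitivity (C / (Num.sqrt (C * N i) * Num.sqrt (C * N j)) *
                \sum_x psi i x * psi j x).
    by rewrite mulr_sumr; apply: eq_bigr => x _; field; rewrite !s0.
  rewrite ortho; case: eqP => [->|_]; last by rewrite mulr0.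
  by rewrite -expr2 sq mulr1n mulrAC divff// mulf_neq0// gt_eqF.
split=> //; first exact: orthonormal_complete on.
move=> j; split.
  (* A function of norm 1 cannot vanish identically. *)
  apply: contrapT => z.
  have := on j j; rewrite eqxx /L2dot big1 => [/eqP|x _].
    by rewrite eq_sym oner_eq0.
  have [->|xn0] := eqVneq (psi j x / Num.sqrt (C * N j)) 0; first by rewrite mulr0.
  by case: z; exists x.
move=> x; rewrite /laplacian.
have -> : nu j / C * (psi j x / Num.sqrt (C * N j)) =
   C^-1 / Num.sqrt (C * N j) * (nu j * psi j x) by field; rewrite s0 gt_eqF.
rewrite -eig mulr_sumr -mulrN -sumrN mulr_sumr.
by apply: eq_bigr => y _; field; rewrite s0 gt_eqF.
Qed.

(** * The eigenvectors of the two graphs *)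

Definition spectrum (R : realType) : seq R :=
  let r := Num.sqrt 5 in [:: 0; 2; 3; 3; 3 + r; 3 - r].

Definition sqnorms (R : realType) : seq R := [:: 6; 2; 2; 30; 40; 40].

Definition basis_X (R : realType) : seq (seq R) :=
  let r := Num.sqrt 5 in
  [:: [:: 1; 1; 1; 1; 1; 1];
      [:: 1; - 1; 0; 0; 0; 0];
      [:: 0; 0; 0; 0; 1; - 1];
      [:: 2; 2; - 4; 2; - 1; - 1];
      [:: 2; 2; 1 - r; - 3 - r; r - 1; r - 1];
      [:: 2; 2; 1 + r; - 3 + r; - r - 1; - r - 1]].

(** The parameter [e] is a sign, chosen later according to whether the bijection
    of the boundary sets preserves or reverses the labels. *)
Definition basis_Xbar (R : realType) (e : R) : seq (seq R) :=
  let r := Num.sqrt 5 in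
  [:: [:: 1; 1; 1; 1; 1; 1];
      [:: e; - e; 0; 0; 0; 0];
      [:: 0; 0; 1; - 1; 0; 0];
      [:: 2; 2; - 1; - 1; - 4; 2];
      [:: 2; 2; - 1 - r; - 1 - r; 1 + r; r - 3];
      [:: 2; 2; - 1 + r; - 1 + r; 1 - r; - r - 3]].

Definition entry (R : realType) (rows : seq (seq R)) (j x : 'I_6) : R :=
  nth 0 (nth [::] rows j) x.

Lemma sqrt5K (R : realType) : Num.sqrt (5 : R) * Num.sqrt 5 = 5.
Proof. by rewrite -expr2 sqr_sqrtr. Qed.

(* The entries are polynomials in sqrt 5, so every identity between them is
   checked entry by entry, modulo the relation sqrt 5 * sqrt 5 = 5. *)
Ltac ord6_cases i := case: i => [[|[|[|[|[|[|i]]]]]] //= ?].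

Lemma eigen_X (R : realType) (j x : 'I_6) :
  \sum_(y | graph_X x y) (entry (basis_X R) j x - entry (basis_X R) j y) =
  (spectrum R)`_j * entry (basis_X R) j x.
Proof.
have := sqrt5K R; rewrite /entry /spectrum /basis_X.
move: (Num.sqrt (5 : R)) => r r2.
rewrite big_mkcond /= !big_ord_recl big_ord0.
ord6_cases x; ord6_cases j.
all: by rewrite /edge_rel /bump /=; ring: r2.
Qed.

Lemma eigen_Xbar (R : realType) (e : R) (j x : 'I_6) :
  \sum_(y | graph_Xbar x y)
    (entry (basis_Xbar e) j x - entry (basis_Xbar e) j y) =
  (spectrum R)`_j * entry (basis_Xbar e) j x.
Proof.
have := sqrt5K R; rewrite /entry /spectrum /basis_Xbar.
move: (Num.sqrt (5 : R)) => r r2.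
rewrite big_mkcond /= !big_ord_recl big_ord0.
ord6_cases x; ord6_cases j.
all: by rewrite /edge_rel /bump /=; ring: r2.
Qed.

Lemma orthogonal_X (R : realType) (i j : 'I_6) :
  \sum_x entry (basis_X R) i x * entry (basis_X R) j x =
  (sqnorms R)`_i *+ (i == j).
Proof.
have := sqrt5K R; rewrite /entry /basis_X -val_eqE.
move: (Num.sqrt (5 : R)) => r r2; rewrite !big_ord_recl big_ord0.
ord6_cases i; ord6_cases j.
all: by rewrite ?mulr0n ?mulr1n; ring: r2.
Qed.

Lemma orthogonal_Xbar (R : realType) (e : R) (i j : 'I_6) : e * e = 1 ->
  \sum_x entry (basis_Xbar e) i x * entry (basis_Xbar e) j x =
  (sqnorms R)`_i *+ (i == j).
Proof.
move=> e2; have := sqrt5K R; rewrite /entry /basis_Xbar -val_eqE.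
move: (Num.sqrt (5 : R)) => r r2; rewrite !big_ord_recl big_ord0.
ord6_cases i; ord6_cases j.
all: by rewrite ?mulr0n ?mulr1n; ring: r2 e2.
Qed.

Lemma sqnorms_gt0 (R : realType) (j : 'I_6) : 0 < (sqnorms R)`_j.
Proof. by ord6_cases j; rewrite ltr0n. Qed.

Lemma B_val (w : {x : 'I_6 | x \in B}) :
  val w = 0%N :> nat \/ val w = 1%N :> nat.
Proof. by case: w => x /=; rewrite inE !eqSS => /orP[]/eqP; [left|right]. Qed.

(** [B] and [Bbar] consist of the points 0 and 1 of ['I_6], so an injection is
    determined by the image of 0, which [isospectral_on_B] turns into a sign. *)
Lemma B_inj_val (Phi : {x : 'I_6 | x \in B} -> {x : 'I_6 | x \in Bbar})
    (v x : {x : 'I_6 | x \in B}) :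
  injective Phi -> val v = 0%N :> nat ->
  val (Phi x) =
  (if val x == 0%N :> nat then nat_of_ord (val (Phi v))
   else val (Phi v) == 0%N :> nat) :> nat.
Proof.
move=> Phi_inj v0; case: ifP => [/eqP x0|xn0].
  by have -> : x = v by do 2 apply: val_inj; rewrite [LHS]x0.
have : val (Phi x) != val (Phi v) :> nat.
  by apply: contraFN xn0 => /eqP/val_inj/val_inj/Phi_inj ->; rewrite v0.
by case: (B_val (Phi v)) => ->; case: (B_val (Phi x)) => ->.
Qed.

Lemma isospectral_on_B (R : realType) (C : R) (hC : 0 < C)
    (Phi : {x : 'I_6 | x \in B} -> {x : 'I_6 | x \in Bbar}) :
  bijective Phi ->
  exists (lambda : 'I_6 -> R) (phi phibar : 'I_6 -> 'I_6 -> R),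
    [/\ complete_orthonormal_eigenfamily graph_X
          (fun=> C) (fun _ _ => 1) lambda phi,
        complete_orthonormal_eigenfamily graph_Xbar
          (fun=> C) (fun _ _ => 1) lambda phibar &
        forall j x, phi j (val x) = phibar j (val (Phi x))].
Proof.
move=> /bij_inj Phi_inj.
have v1B : ord0 \in B by rewrite inE.
pose v1 : {x : 'I_6 | x \in B} := exist _ ord0 v1B.
(* +1 if Phi fixes the first label, -1 if it exchanges the two labels. *)
pose e : R := (-1) ^+ val (Phi v1).
have e2 : e * e = 1 by rewrite -expr2 sqrr_sign.
exists (fun j => (spectrum R)`_j / C),
  (fun j x => entry (basis_X R) j x / Num.sqrt (C * (sqnorms R)`_j)),
  (fun j x => entry (basis_Xbar e) j x / Num.sqrt (C * (sqnorms R)`_j)).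
split.
- exact: (normalized_eigenfamily hC (@sqnorms_gt0 R) (@orthogonal_X R)
           (@eigen_X R)).
- apply: (normalized_eigenfamily hC (@sqnorms_gt0 R) _ (@eigen_Xbar R e)).
  by move=> i j; exact: orthogonal_Xbar.
move=> j x; congr (_ / _).
rewrite /entry (B_inj_val (v := v1) _ Phi_inj)// /e.
case: (B_val (Phi v1)) => ->; case: (B_val x) => -> /=.
all: by ord6_cases j; rewrite ?expr0 ?expr1 ?opprK.
Qed.

(** * Random walks *)

Fixpoint nstep (R : realType) (V : finType) (p : V -> V -> R) (t : nat)
    (x z : V) : R :=
  if t is t'.+1 then \sum_y p x y * nstep p t' y z else (x == z)%:R.

(** The Laplacian at x has a term - u(x) / C for each neighbour of x; together
    they make up the part - deg(x) / C of the diagonal transition probability. *)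
Lemma transition_sum (R : realType) (V : finType) (G : sgraph V) (C : R)
    (u : V -> R) (x : V) :
  \sum_y transition G C x y * u y =
  u x + laplacian G (fun=> C) (fun _ _ => 1) u x.
Proof.
rewrite /laplacian mulr_sumr /degree.
rewrite (bigID (G x)) /= (bigD1 (P := fun y => ~~ G x y) x) /=; last by rewrite (adj_irr G).
rewrite [X in _ + (_ + X)]big1 => [|y /andP[/negbTE Gxy /negbTE yx]]; last first.
  by rewrite /transition Gxy eq_sym yx mul0r.
rewrite {2}/transition (adj_irr G) eqxx addr0.
rewrite (eq_bigr (fun y => C^-1 * (1 * (u y - u x)) + C^-1 * u x)) => [|y Gxy].
  rewrite big_split /= (eq_bigl (mem [set y | G x y]%SET) (fun=> C^-1 * u x)).
    by rewrite sumr_const -mulr_natl; ring.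
  by move=> y; rewrite !inE.
by rewrite /transition Gxy; ring.
Qed.

(** For t = 0 this is the expansion of the indicator of z in the eigenbasis, whose
    coefficients are C * phi_j(z); each step multiplies the j-th term by the
    eigenvalue 1 - lambda_j of the transition operator. *)
Lemma nstep_spectral (R : realType) (V J : finType) (G : sgraph V) (C : R)
    (lambda : J -> R) (phi : J -> V -> R) (t : nat) (x z : V) :
  complete_orthonormal_eigenfamily G (fun=> C) (fun _ _ => 1) lambda phi ->
  nstep (transition G C) t x z =
  C * \sum_j (1 - lambda j) ^+ t * phi j x * phi j z.
Proof.
move=> [on cpl eig]; elim: t x => [|t IH] x /=.
  have [c cE] := cpl (fun x => (x == z)%:R).
  rewrite cE mulr_sumr; apply: eq_bigr => j _.
  have -> : c j = C * phi j z.
    transitivity (L2dot (fun=> C) (fun x => (x == z)%:R) (phi j)).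
      rewrite /L2dot (eq_bigr (fun x => \sum_i c i * (C * phi i x * phi j x))).
        rewrite exchange_big /= (bigD1 j) //= -mulr_sumr [X in _ * X]on eqxx mulr1.
        rewrite big1 ?addr0// => i /negbTE ij.
        by rewrite -mulr_sumr [X in _ * X]on ij mulr0.
      by move=> y _; rewrite cE mulr_sumr mulr_suml; apply: eq_bigr => i _; ring.
    rewrite /L2dot (bigD1 z)//= eqxx mulr1 big1 ?addr0// => y /negbTE ->.
    by rewrite mulr0 mul0r.
  by rewrite expr0; ring.
under eq_bigr do rewrite IH mulrCA mulr_sumr.
rewrite -mulr_sumr exchange_big; congr (_ * _); apply: eq_bigr => j _ /=.
transitivity ((1 - lambda j) ^+ t * phi j z *
              \sum_y transition G C x y * phi j y).
  by rewrite mulr_sumr; apply: eq_bigr => y _; ring.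
by rewrite transition_sum -[laplacian _ _ _ _ _]opprK (eig j).2 exprS; ring.
Qed.

(** The Markov property is stated for complete histories, so the induction on the
    number of steps is carried out for the walk continuing a given history of
    arbitrary length: splitting according to the next position only requires a
    sum over the vertices, not over all paths. *)
Lemma random_walk_law (R : realType) (V : finType) (p : V -> V -> R) (y : V)
    (d : measure_display) (T : measurableType d) (P : probability T R)
    (H : nat -> T -> V) (t : nat) (z : V) :
  random_walk p y P H -> P [set w | H t w = z] = (nstep p t y z)%:E.
Proof.
move=> [mH H0 step].
pose cyl s h : set T := [set w | forall i, (i <= s)%N -> H i w = h i].
have mHz s x : measurable [set w | H s w = x] by exact: mH.
have mcyl s h : measurable (cyl s h).
  have -> : cyl s h = \bigcap_(i in [set i | (i <= s)%N]) [set w | H i w = h i].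
    by apply/seteqP; split.
  by apply: bigcap_measurable => [|i _]; [exists 0%N | exact: mHz].
have key k s h : P (cyl s h `&` [set w | H (s + k)%N w = z]) =
                 (P (cyl s h) * (nstep p k (h s) z)%:E)%E.
  elim: k s h => [|k IH] s h /=.
    rewrite addn0; case: eqP => [hz|hz]; rewrite ?mule1 ?mule0.
      congr (P _); apply/seteqP; split=> [w []//|w cw]; split=> //=.
      by rewrite cw.
    rewrite -(measure0 P); congr (P _); apply/seteqP; split=> // w [cw /= Hz].
    by apply: hz; rewrite -Hz cw.
  (* The history h up to time s, followed by the position x. *)
  pose h' x i := if (i <= s)%N then h i else x.
  have cylE x : cyl s (h' x) = cyl s h.
    by apply/seteqP; split=> w cw i /[dup] is_ /cw; rewrite /h' is_.
  have h'S x : h' x s.+1 = x by rewrite /h' ltnn.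
  have h's x : h' x s = h s by rewrite /h' leqnn.
  have -> : cyl s h `&` [set w | H (s + k.+1)%N w = z] =
      \bigcup_(x in [set` predT])
        (cyl s.+1 (h' x) `&` [set w | H (s.+1 + k)%N w = z]).
    rewrite addnS -addSn; apply/seteqP; split=> [w [cw Hz]|w [x _ [cw Hz]]].
      exists (H s.+1 w) => //; split=> // i.
      rewrite leq_eqVlt ltnS => /orP[/eqP ->|is_]; first by rewrite h'S.
      by rewrite /h' is_ cw.
    by split=> // i is_; rewrite cw ?leqW// /h' is_.
  rewrite measure_fin_bigcup //=; last 2 first.
    - apply/trivIsetP => x x' _ _ /eqP xx'; apply/seteqP; split=> // w [[cw _] [cw' _]].
      by apply: xx'; rewrite -(h'S x) -(h'S x') -cw// cw'.
    - by move=> x _; apply: measurableI.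
  rewrite -(bigfs _ (index_enum_uniq V)) /=; last by move=> i _; rewrite mem_index_enum.
  rewrite -(fineK (fin_num_measure P _ (mcyl s h))).
  rewrite -EFinM mulr_sumr -sumEFin; apply: eq_bigr => x _.
  have stepE : P (cyl s.+1 (h' x)) = (P (cyl s (h' x)) * (p (h' x s) (h' x s.+1))%:E)%E.
    exact: step.
  by rewrite IH stepE cylE h's h'S -muleA EFinM (fineK (fin_num_measure P _ (mcyl s h))).
have cyl0 : cyl 0%N (fun=> y) = [set w | H 0%N w = y].
  apply/seteqP; split=> w /= => [cw|Hw i]; first by rewrite cw.
  by rewrite leqn0 => /eqP ->.
have := key t 0%N (fun=> y); rewrite cyl0 H0 mul1e add0n => <-.
rewrite (measureDI P (mHz t z) (mHz 0%N y)) setIC.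
have PC0 : P (~` [set w | H 0%N w = y]) = 0%E.
  by rewrite probability_setC// H0 subee.
rewrite [X in (X + _)%E](_ : _ = 0%E) ?add0e//.
apply: (subset_measure0 _ _ _ PC0); last by move=> w [].
- exact: measurableD.
- exact: measurableC.
Qed.

Theorem lemmaA1 (R : realType) (C : R) (hC : 0 < C) :
  (forall Phi : {x : 'I_6 | x \in B} -> {x : 'I_6 | x \in Bbar},
    bijective Phi ->
    exists (lambda lambdabar : 'I_6 -> R) (phi phibar : 'I_6 -> 'I_6 -> R),
      [/\ complete_orthonormal_eigenfamily graph_X
            (fun=> C) (fun _ _ => 1) lambda phi,
          complete_orthonormal_eigenfamily graph_Xbar
            (fun=> C) (fun _ _ => 1) lambdabar phibar,
          forall j, lambda j = lambdabar j &
          forall j x, phi j (val x) = phibar j (val (Phi x))])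
  /\
  (4 <= C ->
    forall Phi : {x : 'I_6 | x \in B} -> {x : 'I_6 | x \in Bbar},
    bijective Phi ->
    forall (y z : {x : 'I_6 | x \in B}) (t : nat)
      (d : measure_display) (T : measurableType d) (P : probability T R)
      (H : nat -> T -> 'I_6)
      (dbar : measure_display) (Tbar : measurableType dbar)
      (Pbar : probability Tbar R) (Hbar : nat -> Tbar -> 'I_6),
    random_walk (transition graph_X C) (val y) P H ->
    random_walk (transition graph_Xbar C) (val (Phi y)) Pbar Hbar ->
    P [set w | H t w = val z] = Pbar [set w | Hbar t w = val (Phi z)]).
Proof.
split=> [Phi bij|_ Phi bij y z t d T P H dbar Tbar Pbar Hbar wH wHbar].
  have [l [phi [phibar [? ? ?]]]] := isospectral_on_B hC bij.
  by exists l, l, phi, phibar; split.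
have [l [phi [phibar [eX eXbar phiE]]]] := isospectral_on_B hC bij.
rewrite (random_walk_law _ _ wH) (random_walk_law _ _ wHbar).
rewrite (nstep_spectral _ _ _ eX) (nstep_spectral _ _ _ eXbar).
by congr (_ * _)%:E; apply: eq_bigr => j _; rewrite !phiE.
Qed.
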